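(* Let $G$ be a finite simple bipartite graph with (non-empty) partite sets $U$ and $W$. For each $u\in U$ and $Y\subseteq W$, let $d_Y(u)$ be the number of neighbors of $u$ in $Y$, and let $K:=\max_{\emptyset\ne Y\subseteq W}\rho\big((d_Y(u))_{u\in U}\big)$. Then $$\mathcal M(G)\le\lambda_{\max}(G)\le\sqrt{2(\log K+1)(\log|W|+4)}\,\mathcal M(G).$$
   Context: $\lambda_{\max}(G)$ is the largest eigenvalue of the adjacency matrix $A$ of $G$. For subsets $X,Y$ of the vertex set $V$, $e(X,Y)$ is the number of ordered pairs $(x,y)\in X\times Y$ with $xy$ an edge (equivalently $\xi^tA\eta$ for characteristic vectors $\xi,\eta$), and $\mathcal M(G):=\max_{\emptyset\ne X,Y\subseteq V}e(X,Y)/\sqrt{|X||Y|}$. For a finite sequence $d$ of non-negative reals, let $d_1\ge\dots\ge d_n\ge0$ be its non-increasing rearrangement, let $k\in[1,n]$ be the smallest positive integer with $d_1^2+\dots+d_k^2\ge d_{k+1}^2+\dots+d_n^2$, and set $\rho(d):=d_1/d_k$ if $d_k\ne0$, $\rho(d):=1$ if $d_k=0$. $\log$ is the natural logarithm. *)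

(* Defs.v *)
From HB Require Import structures.
From mathcomp Require Import classical_sets reals exp.
From mathcomp Require Import all_boot all_order all_algebra.

Set Implicit Arguments.
Unset Strict Implicit.
Unset Printing Implicit Defensive.

Import Order.TTheory GRing.Theory Num.Theory.
Local Open Scope ring_scope.

Definition simple_graph (V : finType) (e : rel V) : Prop :=
  symmetric e /\ irreflexive e.

Definition bipartite_sets (V : finType) (e : rel V) (U W : {set V}) : Prop :=
  [/\ U :&: W = finset.set0, U :|: W = [set: V] &
      forall x y, e x y ->
        (x \in U) && (y \in W) || (x \in W) && (y \in U)].

Definition adjacency (R : realType) (V : finType) (e : rel V) : 'M[R]_#|V| :=
  \matrix_(i, j) (e (enum_val i) (enum_val j))%:R.

(* When [e] is symmetric and [V] is inhabited, the set of eigenvalues is finite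
   and non-empty, so that this supremum is a maximum. *)
Definition lambda_max (R : realType) (V : finType) (e : rel V) : R :=
  sup [set a : R | eigenvalue (adjacency R e) a]%classic.

Definition edges_between (V : finType) (e : rel V) (X Y : {set V}) : nat :=
  #|[set p in setX X Y | e p.1 p.2]|.

(* The default value 0 is harmless, as all the ratios are non-negative. *)
Definition max_density (R : realType) (V : finType) (e : rel V) : R :=
  \big[Num.max/0]_(P : {set V} * {set V} | (P.1 != finset.set0) && (P.2 != finset.set0))
     ((edges_between e P.1 P.2)%:R / Num.sqrt (#|P.1|%:R * #|P.2|%:R)).

(* For [d] already sorted in non-increasing order:
   the least k in {1, ..., size d} such that the first k terms of [d] have at
   least the sum of squares of the remaining ones; k = size d always qualifies
   when d is non-empty. *)
Definition half_energy_index (R : realType) (d : seq R) : nat :=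
  head 0%N [seq k <- iota 1 (size d) |
    \sum_(x <- drop k d) x ^+ 2 <= \sum_(x <- take k d) x ^+ 2].

(* Sequences are indexed from 0, so that d_1 is [s`_0] and d_k is [s`_k.-1]. *)
Definition rho (R : realType) (d : seq R) : R :=
  let s := sort >=%R d in
  let dk := s`_(half_energy_index s).-1 in
  if dk != 0 then s`_0 / dk else 1.

Definition degree_in (V : finType) (e : rel V) (Y : {set V}) (u : V) : nat :=
  #|[set y in Y | e u y]|.

(* The default value 0 is harmless, as [rho] is non-negative here. *)
Definition max_rho (R : realType) (V : finType) (e : rel V) (U W : {set V}) : R :=
  \big[Num.max/0]_(Y : {set V} | (Y != finset.set0) && (Y \subset W))
     rho [seq (degree_in e Y u)%:R : R | u <- enum U].

(* Main.v *)
(** Let [B] be the biadjacency matrix and [M] the maximal density.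
    Lower bound: the Rayleigh quotient of the adjacency matrix is bounded by its
    largest eigenvalue, and is evaluated on weighted indicators of [X] and [Y].
    Upper bound: fix [Y] in [W] and sort the degrees [d_Y(u)] decreasingly; the
    sum of the first [j] is at most [M sqrt(j |Y|)].  Hence the first [k] squares
    sum to at most [M^2 |Y| (1 + ln (d_1 / d_k))], and for the index [k] in the
    definition of [rho] they carry half of the energy, so that
    [|B 1_Y|^2 <= D |Y|] with [D = 2 M^2 (1 + ln K)].
    By duality, for [p >= 0] on [U] the vector [g = B^T p] has sums over any [Y]
    at most [|p| sqrt(D |Y|)]; its [j]-th largest entry is therefore at most
    [|p| sqrt(D / j)], and [|g|^2 <= D |p|^2 (1 + ln |W|)].  Finally, the two
    halves of an eigenvector for a non-zero eigenvalue have equal norms. *)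
Require Import Defs.
From HB Require Import structures.
From mathcomp Require Import classical_sets reals exp.
From mathcomp Require Import all_boot all_order all_algebra.
From mathcomp Require Import complex ring lra.

Set Implicit Arguments.
Unset Strict Implicit.
Unset Printing Implicit Defensive.

Import Order.TTheory GRing.Theory Num.Theory.
Local Open Scope ring_scope.

(** * The Rayleigh principle for real symmetric matrices *)

Section SymmetricMatrix.
Local Open Scope sesquilinear_scope.

(** Over the complex closure the matrix is Hermitian, hence unitarily diagonalizable with real
    diagonal [D]. The witness [a] is the largest diagonal entry, and in the coordinates [w] of [v]
    the form is the sum of [D_j |w_j|^2]. *)
Lemma symmetric_rayleigh (R : rcfType) n (A : 'M[R]_n) :
  (0 < n)%N -> A^T = A ->
  exists2 a, eigenvalue A a &
    forall v : 'rV_n, (v *m A *m v^T) 0 0 <= a * (v *m v^T) 0 0.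
Proof.
move=> n_gt0 symA; pose C : numClosedFieldType := (R[i])%C.
pose io : {rmorphism R -> C} := real_complex R.
pose AC : 'M[C]_n := map_mx io A.
have ioK (x : C) : x \is Num.real -> io (complex.Re x) = x.
  exact: RRe_real.
have io_real x : io x \is Num.real by apply/complex_realP; exists x.
have ioC x : Num.conj (io x) = io x.
  exact/CrealP.
have AC_herm : AC \is hermsymmx.
  apply: realsym_hermsym; last by apply/mxOverP => i j; rewrite mxE.
  apply/is_hermitianmxP/matrixP => i j; rewrite expr0 scale1r !mxE /=.
  by rewrite -[in LHS]symA mxE.
have Dreal := hermitian_spectral_diag_real AC_herm.
have /hermitian_normalmx /orthomx_spectralP := AC_herm.
have Pu := spectral_unitarymx AC; have Punit := spectral_unit AC.
move: Dreal Pu Punit.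
set P := spectralmx AC; set D := spectral_diag AC => Dreal Pu Punit defA.
pose r i := complex.Re (D 0 i).
have ior i : io (r i) = D 0 i by apply: ioK; apply/mxOverP.
pose i0 := [arg max_(i > Ordinal n_gt0) r i]%O.
have r_max i : r i <= r i0.
  by rewrite /i0; case: Order.TotalTheory.arg_maxP => // j _ /(_ i isT).
exists (r i0).
  (* The eigenvector found is complex, but being an eigenvalue is invariant under field
     extension. *)
  have -> : eigenvalue A (r i0) = eigenvalue AC (D 0 i0).
    by rewrite -ior eigenvalue_map.
  apply/eigenvalueP; exists (row i0 P).
    rewrite -row_mul defA mulmxA mulmxA mulmxV // mul1mx row_mul.
    by rewrite row_diag_mx -scalemxAl -rowE.
  apply: contra_eq_neq (congr1 (row i0) (mulmxV Punit)) => Pi0.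
  rewrite row_mul Pi0 mul0mx row1 eq_sym; apply/eqP => /matrixP/(_ 0 i0)/eqP.
  by rewrite !mxE !eqxx oner_eq0.
move=> v; rewrite -lecR rmorphM /=.
pose vC := map_mx io v; pose w := vC *m P^t*.
have mapE (B : 'M[R]_1) : io (B 0 0) = (map_mx io B) 0 0 by rewrite mxE.
rewrite -/(io _) -/(io (r i0)) -/(io ((v *m v^T) 0 0)) !mapE !map_mxM -/AC -/vC.
have -> : map_mx io v^T = vC^t*.
  by apply/matrixP => i j; rewrite !mxE ioC.
have -> : vC *m vC^t* = w *m w^t*.
  rewrite /w trmx_mul map_mxM trmxCK mulmxA -(mulmxA _ _ P).
  rewrite -[X in _ *m (_ *m X)]trmxCK; move: Pu; rewrite -trmxC_unitary.
  by move=> /unitarymxP ->; rewrite mulmx1.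
have -> : vC *m AC *m vC^t* = w *m diag_mx D *m w^t*.
  by rewrite defA invmx_unitary // /w trmx_mul map_mxM trmxCK !mulmxA.
rewrite mul_mx_diag !mxE mulr_sumr ler_sum // => j _; rewrite !mxE.
rewrite mulrAC mulrC ler_wpM2r ?mul_conjC_ge0 // -ior /io lecR //.
Qed.

End SymmetricMatrix.

(** * Sums of squares of monotone sequences with controlled partial sums *)

Section PartialSums.
Variables (R : realType) (d : nat -> R) (C : R).

(* Summation by parts: numbering the terms from 1, monotonicity gives
   [S_j * d_j <= C] for the partial sums [S_j], so [S_j * (d_j - d_(j+1))] is at
   most [C * (1 - d_(j+1) / d_j) <= C * ln (d_j / d_(j+1))], which telescopes. *)
Lemma sum_sqr_le_ln k :
    (forall i j, (i <= j <= k)%N -> d j <= d i) -> 0 < d k ->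
    (forall j, (j <= k.+1)%N -> (\sum_(i < j) d i) ^+ 2 <= C * j%:R) ->
  \sum_(i < k.+1) d i ^+ 2 <= C * (1 + ln (d 0%N / d k)).
Proof.
move=> d_mono dk_gt0 sumC.
have d_gt0 j : (j <= k)%N -> 0 < d j.
  by move=> jk; apply: lt_le_trans dk_gt0 (d_mono _ _ _); rewrite jk leqnn.
have C_ge0 : 0 <= C by have := sumC 1%N isT; rewrite mulr1; exact/le_trans/sqr_ge0.
have sum_ge j : (j <= k)%N -> j.+1%:R * d j <= \sum_(i < j.+1) d i.
  move=> jk; rewrite mulr_natl -[X in _ *+ X]card_ord -sumr_const ler_sum // => i _.
  by apply: d_mono; rewrite jk andbT -ltnS.
have sum_d j : (j <= k)%N -> (\sum_(i < j.+1) d i) * d j <= C.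
  move=> jk; have j0 : 0 < j.+1%:R :> R by rewrite ltr0n.
  rewrite -(ler_pM2r j0) -mulrA (mulrC (d j)) (le_trans _ (sumC _ _)) //.
  rewrite expr2 ler_wpM2l ?sum_ge // sumr_ge0 // => i _.
  by rewrite ltW // d_gt0 // (leq_trans _ jk) // -ltnS.
(* Subtracting [S_j d_j] makes the induction start from 0 and grow by exactly [S_j (d_j - d_(j+1))];
   the bound [S_k d_k <= C] restores this term at the end and yields the summand 1. *)
have step j : (j <= k)%N ->
    \sum_(i < j.+1) d i ^+ 2 - (\sum_(i < j.+1) d i) * d j <= C * ln (d 0%N / d j).
  elim: j => [_|j IH jk].
    by rewrite !big_ord1 expr2 subrr divff ?gt_eqF ?d_gt0 // ln1 mulr0.
  have dj := d_gt0 _ (ltnW jk); have dSj := d_gt0 _ jk; have d0 := d_gt0 0%N isT.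
  rewrite big_ord_recr [in X in _ - X]big_ord_recr /=.
  have := IH (ltnW jk); have := sum_d _ (ltnW jk).
  set S2 := \sum_(i < _) _ ^+ 2; set S := \sum_(i < _) _ => Sd IHj.
  have lnE : ln (d 0%N / d j.+1) = ln (d 0%N / d j) - ln (d j.+1 / d j).
    rewrite !ln_div ?posrE //; ring.
  have ln_le : ln (d j.+1 / d j) <= d j.+1 / d j - 1.
    by rewrite -[X in ln X](subrK 1) addrC le_ln1Dx // ltrBrDl addrN divr_gt0.
  have dd : S * (d j - d j.+1) <= C * (1 - d j.+1 / d j).
    have -> : S * (d j - d j.+1) = S * d j * (1 - d j.+1 / d j).
      by field; rewrite gt_eqF.
    rewrite ler_wpM2r // subr_ge0 ler_pdivrMr // mul1r d_mono //.
    by rewrite leqnSn.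
  have : C * (1 - d j.+1 / d j) <= C * - ln (d j.+1 / d j).
    by rewrite ler_wpM2l //; lra.
  rewrite lnE; nra.
have := step _ (leqnn k); have := sum_d _ (leqnn k); lra.
Qed.

(** Each new term is at most an increment of [ln], by [ln (1 + x) <= x] at [x = - 1 / (n + 2)]. *)
Lemma sum_invr_le_ln n : (0 < n)%N ->
  \sum_(i < n) i.+1%:R^-1 <= 1 + ln n%:R :> R.
Proof.
case: n => // n _; elim: n => [|n IH].
  by rewrite big_ord1 invr1 ln1 addr0.
rewrite big_ord_recr /=; apply: le_trans (lerD IH (lexx _)) _.
rewrite -addrA lerD2l -lerBrDl.
have n1 : 0 < n.+1%:R :> R by rewrite ltr0n.
have n2 : 0 < n.+2%:R :> R by rewrite ltr0n.
have le : ln (n.+1%:R / n.+2%:R) <= n.+1%:R / n.+2%:R - 1 :> R.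
  by rewrite -[X in ln X](subrK 1) addrC le_ln1Dx // ltrBrDl addrN divr_gt0.
have e : n.+1%:R / n.+2%:R - 1 = - n.+2%:R^-1 :> R.
  move: n2; rewrite -[n.+2%:R]natr1; move: n.+1%:R => x x1.
  by field; rewrite gt_eqF.
by move: le; rewrite e ln_div ?posrE // lerNr opprB.
Qed.

(** Numbering from 1, monotonicity gives [j d_j <= S_j], so [d_j ^ 2 <= C / j]. Here the last terms
    may vanish. *)
Lemma sum_sqr_le_harmonic n : (0 < n)%N ->
    (forall i j, (i <= j < n)%N -> d j <= d i) ->
    (forall i, (i < n)%N -> 0 <= d i) ->
    (forall j, (j <= n)%N -> (\sum_(i < j) d i) ^+ 2 <= C * j%:R) ->
  \sum_(i < n) d i ^+ 2 <= C * (1 + ln n%:R).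
Proof.
move=> n_gt0 d_mono d_ge0 sumC.
have C_ge0 : 0 <= C.
  by have := sumC 1%N n_gt0; rewrite mulr1; exact/le_trans/sqr_ge0.
apply: le_trans (ler_wpM2l C_ge0 (sum_invr_le_ln n_gt0)).
rewrite mulr_sumr ler_sum // => j _; have j0 : 0 < j.+1%:R :> R by rewrite ltr0n.
rewrite ler_pdivlMr // -(ler_pM2r j0); apply: le_trans (sumC _ (ltn_ord j)).
rewrite -mulrA -expr2 -exprMn ler_sqr ?nnegrE ?mulr_ge0 ?d_ge0 //; last first.
  by apply: sumr_ge0 => i _; rewrite d_ge0 // (leq_trans (ltn_ord i)).
rewrite mulr_natr -[X in _ *+ X]card_ord -sumr_const ler_sum // => i _.
by apply: d_mono; rewrite ltn_ord andbT -ltnS.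
Qed.

End PartialSums.

(** * Decreasing rearrangements and the ratio [rho] *)

Section DecreasingRearrangement.
Variable R : realType.
Implicit Type d s : seq R.

(** The filtered list is strictly increasing, so its head is its minimum; it is non-empty because
    [size s] leaves an empty tail. *)
Lemma half_energy_indexP s : s != [::] ->
  [/\ (0 < half_energy_index s <= size s)%N,
      \sum_(x <- drop (half_energy_index s) s) x ^+ 2
        <= \sum_(x <- take (half_energy_index s) s) x ^+ 2 &
      forall j, (0 < j < half_energy_index s)%N ->
        \sum_(x <- take j s) x ^+ 2 < \sum_(x <- drop j s) x ^+ 2].
Proof.
rewrite -size_eq0 -lt0n /half_energy_index => s_gt0.
set P := fun k => _ <= _; pose L := [seq k <- iota 1 (size s) | P k].
have memL k : (k \in L) = P k && (0 < k <= size s)%N.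
  by rewrite mem_filter mem_iota add1n ltnS.
have : size s \in L.
  rewrite memL s_gt0 leqnn !andbT /P drop_size big_nil.
  by apply: sumr_ge0 => i _; exact: sqr_ge0.
have : sorted ltn L by apply: sorted_filter (iota_ltn_sorted _ _); exact: ltn_trans.
rewrite -/L; case defL : L => [|k L'] //= /(order_path_min ltn_trans)/allP kmin _.
have := memL k; rewrite defL mem_head => /esym/andP[Pk k_bd].
split=> // j /andP[j0 jk]; rewrite ltNge; apply/negP => Pj.
have : j \in L.
  by rewrite memL [P j]Pj j0 (leq_trans (ltnW jk)) //; case/andP: k_bd.
rewrite defL inE => /predU1P[jE|/kmin]; first by rewrite jE ltnn in jk.
by rewrite ltnNge ltnW.
Qed.

Lemma sort_ge_nth d i j : (i <= j < size d)%N ->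
  (sort >=%R d)`_j <= (sort >=%R d)`_i.
Proof.
move=> /andP[ij jd]; have sorted_d : sorted >=%R (sort >=%R d).
  by apply: sort_sorted => x y; exact: le_total.
have ge_trans : transitive (>=%R : rel R) by move=> y x z xy /le_trans; apply.
apply: (sorted_leq_nth ge_trans _ 0 sorted_d) => //; first exact: lexx.
  by rewrite inE size_sort (leq_ltn_trans ij).
by rewrite inE size_sort.
Qed.

Lemma sort_ge0_nth d i : all (>= 0) d -> 0 <= (sort >=%R d)`_i.
Proof.
rewrite -(all_sort _ >=%R) => /(all_nthP 0) d_ge0.
by case: (ltnP i (size (sort >=%R d))) => [/d_ge0|/(nth_default 0) ->].
Qed.

Lemma rho_ge1 d : all (>= 0) d -> 1 <= rho d.
Proof.
move=> d_ge0; rewrite /rho; case: ifPn => // dk_neq0.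
set k := half_energy_index _ in dk_neq0 *.
have dk_gt0 : 0 < (sort >=%R d)`_k.-1 by rewrite lt_def dk_neq0 sort_ge0_nth.
(* The index is in range: otherwise [nth] would return its default 0, against [dk_neq0]. *)
rewrite ler_pdivlMr // mul1r sort_ge_nth //= ltnNge -(size_sort >=%R).
by apply: contra dk_neq0 => /(nth_default 0) ->.
Qed.

Lemma sum_take d j (F : R -> R) : (j <= size d)%N ->
  \sum_(x <- take j d) F x = \sum_(i < j) F d`_i.
Proof.
move=> jd; rewrite (big_nth 0) size_takel // big_mkord.
by apply: eq_bigr => i _; rewrite nth_take.
Qed.

(** The factor 2 reduces the whole sum to its first [k] terms, to which [sum_sqr_le_ln] applies when
    [d_k] is positive. *)
Lemma sum_sqr_le_rho d C : d != [::] -> all (>= 0) d ->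
    (forall j, (j <= size d)%N ->
      (\sum_(i < j) (sort >=%R d)`_i) ^+ 2 <= C * j%:R) ->
  \sum_(x <- d) x ^+ 2 <= 2 * C * (1 + ln (rho d)).
Proof.
move=> d_neq0 d_ge0 sumC.
have C_ge0 : 0 <= C.
  have := sumC 1%N; rewrite lt0n size_eq0 d_neq0 mulr1 => /(_ isT).
  exact/le_trans/sqr_ge0.
have s_neq0 : sort >=%R d != [::] by rewrite -size_eq0 size_sort size_eq0.
rewrite /rho; set s := sort _ _ in sumC s_neq0 *.
have szs : size s = size d by rewrite size_sort.
have -> : \sum_(x <- d) x ^+ 2 = \sum_(x <- s) x ^+ 2.
  by apply/perm_big; rewrite perm_sym perm_sort.
have [] := half_energy_indexP s_neq0.
set k := half_energy_index s; case: k => //= k k_le tail_le k_min.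
have {tail_le} : \sum_(x <- s) x ^+ 2 <= 2 * \sum_(i < k.+1) s`_i ^+ 2.
  rewrite -{1}(cat_take_drop k.+1 s) big_cat /= -(sum_take (fun x => x ^+ 2)) //.
  by rewrite mulr_natl mulr2n lerD2l.
move=> /le_trans; apply; rewrite -mulrA ler_pM2l ?ltr0n //.
case: ifPn => [sk_neq0|/negPn/eqP sk0].
  apply: sum_sqr_le_ln.
  - by move=> i j /andP[ij jk]; rewrite sort_ge_nth // ij -szs (leq_ltn_trans jk).
  - by rewrite lt_def sk_neq0 sort_ge0_nth.
  - by move=> j jk; rewrite sumC // -szs (leq_trans jk).
(* The index is now [k.+1]. If [d_k = 0] with index at least 2, the tail starting at that zero term
   vanishes, so the preceding index would already qualify, against minimality. *)
have k0 : k = 0%N.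
  case: k => // k in k_le k_min sk0 *.
  have := k_min k.+1; rewrite ltnSn => /(_ isT).
  rewrite [X in _ < X](_ : _ = 0) ?ltNge ?sumr_ge0 // => [i _|]; first exact: sqr_ge0.
  rewrite big_seq big1 // => x /(nthP 0)[j]; rewrite size_drop ltn_subRL => jlt.
  rewrite nth_drop => <-; apply/eqP; rewrite sqrf_eq0 eq_le sort_ge0_nth // andbT.
  by rewrite -[leRHS]sk0; apply: sort_ge_nth; rewrite leq_addr -szs.
by rewrite k0 big_ord1 -[in s`_0]k0 sk0 expr0n ln1 addr0 mulr1.
Qed.

(** Sorting the points of [A] by their values, the first [j] values are those of [f] on a subset of
    cardinality [j]. *)
Lemma sort_partial_sums (T : finType) (A : {set T}) (f : T -> R) C :
    (forall X : {set T}, X \subset A -> (\sum_(x in X) f x) ^+ 2 <= C * #|X|%:R) ->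
  forall j, (j <= #|A|)%N ->
    (\sum_(i < j) (sort >=%R [seq f x | x <- enum A])`_i) ^+ 2 <= C * j%:R.
Proof.
move=> sumC j jA; rewrite sort_map; set t := sort _ (enum A).
have szt : size t = #|A| by rewrite size_sort cardE.
have t_uniq : uniq (take j t) by rewrite take_uniq // sort_uniq enum_uniq.
have cardX : #|[set x in take j t]| = j.
  by rewrite cardsE (card_uniqP t_uniq) size_takel ?szt.
have XA : [set x in take j t] \subset A.
  by apply/subsetP => x; rewrite inE => /mem_take; rewrite mem_sort mem_enum.
have := sumC _ XA; rewrite cardX; congr (_ ^+ 2 <= _).
rewrite -(sum_take id) ?size_map ?szt // -map_take big_map big_uniq //=.
by apply: eq_bigl => x; rewrite inE.
Qed.

End DecreasingRearrangement.

(** Lagrange's identity: twice the difference of the sides is the double sum of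
    [(a_i b_j - a_j b_i)^2]. *)
Lemma cauchy_schwarz_sum (R : realDomainType) (I : finType) (P : pred I)
    (a b : I -> R) :
  (\sum_(i | P i) a i * b i) ^+ 2
    <= (\sum_(i | P i) a i ^+ 2) * (\sum_(i | P i) b i ^+ 2).
Proof.
rewrite -(ler_pM2l (ltr0n R 2)) mulr_natl mulr2n [leRHS]mulr_natl mulr2n.
rewrite {2}[_ * \sum_(i | P i) b i ^+ 2]mulrC expr2 !big_distrlr /= -!big_split /=.
apply: ler_sum => i _; rewrite -!big_split ler_sum //= => j _.
rewrite -subr_ge0; have := sqr_ge0 (a i * b j - a j * b i); congr (0 <= _); ring.
Qed.

(** * Edge counts, degrees and the adjacency form *)

Section Graph.
Variables (R : realType) (V : finType) (e : rel V).
Implicit Types (X Y : {set V}) (f : V -> R).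

Lemma degree_inE Y u : (degree_in e Y u)%:R = \sum_(y in Y) (e u y)%:R :> R.
Proof.
rewrite /degree_in -sum1_card natr_sum big_mkcond [RHS]big_mkcond /=.
by apply: eq_bigr => y _; rewrite inE; case: (y \in Y); case: (e u y).
Qed.

Lemma edges_betweenE X Y :
  (edges_between e X Y)%:R = \sum_(x in X) (degree_in e Y x)%:R :> R.
Proof.
rewrite /edges_between -sum1_card natr_sum.
under [RHS]eq_bigr do rewrite degree_inE.
rewrite pair_big_dep /= big_mkcond [RHS]big_mkcond /=.
apply: eq_bigr => -[x y] _; rewrite !inE /=.
by case: (x \in X); case: (y \in Y); case: (e x y).
Qed.

Lemma max_density_ge0 : 0 <= max_density R e.
Proof. exact: bigmax_ge_id. Qed.

(** The left side is the square of the edge count between [X] and [Y]. Empty sets, which the maximum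
    leaves out, make it 0. *)
Lemma sqr_sum_degree_le X Y :
  (\sum_(x in X) (degree_in e Y x)%:R) ^+ 2
    <= max_density R e ^+ 2 * #|Y|%:R * #|X|%:R.
Proof.
have [->|X0] := eqVneq X finset.set0.
  by rewrite big_set0 expr0n /= cards0 mulr0.
have [->|Y0] := eqVneq Y finset.set0.
  rewrite big1 ?expr0n ?cards0 ?mulr0 ?mul0r // => x _.
  by rewrite degree_inE big_set0.
have cX : 0 < #|X|%:R :> R by rewrite ltr0n card_gt0.
have cY : 0 < #|Y|%:R :> R by rewrite ltr0n card_gt0.
have XY : 0 < #|X|%:R * #|Y|%:R :> R by rewrite mulr_gt0.
rewrite -mulrA (mulrC #|Y|%:R) -edges_betweenE -(sqr_sqrtr (ltW XY)) -exprMn.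
rewrite ler_sqr ?nnegrE ?mulr_ge0 ?max_density_ge0 ?sqrtr_ge0 //.
rewrite -ler_pdivrMr ?sqrtr_gt0 // /max_density.
by apply: (@le_bigmax_cond _ _ _ _ (X, Y)); rewrite X0 Y0.
Qed.

Lemma adjacency_mulE (v : 'rV[R]_#|V|) (w : V) :
  (v *m adjacency R e) 0 (enum_rank w)
    = \sum_z v 0 (enum_rank z) * (e z w)%:R.
Proof.
rewrite mxE [RHS]big_enum_val /=; apply: eq_bigr => i _.
by rewrite mxE enum_valK enum_rankK.
Qed.

Hypothesis e_sym : symmetric e.

Lemma exists_rayleigh_bound : (0 < #|V|)%N ->
  exists2 a, eigenvalue (adjacency R e) a &
    forall f, \sum_x \sum_y f x * f y * (e x y)%:R <= a * \sum_x f x ^+ 2.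
Proof.
move=> V0; have [|a a_eig a_bd] := @symmetric_rayleigh R _ (adjacency R e) V0.
  by apply/matrixP => i j; rewrite !mxE e_sym.
exists a => // f; have := a_bd (\row_i f (enum_val i)).
rewrite mxE [X in _ <= _ * X]mxE [X in _ -> X <= _]big_enum_val.
rewrite [X in _ -> _ <= _ * X]big_enum_val /=.
congr (_ <= _ * _); last by apply: eq_bigr => i _; rewrite !mxE expr2.
under [RHS]eq_bigr do rewrite big_enum_val.
rewrite exchange_big; apply: eq_bigr => j _; rewrite !mxE mulr_suml.
by apply: eq_bigr => i _; rewrite !mxE mulrAC.
Qed.

(** * The bipartite structure and the lower bound *)

Variables U W : {set V}.
Hypothesis e_bip : bipartite_sets e U W.

Lemma in_partW x : (x \in W) = (x \notin U).
Proof.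
have [UW0 UWT _] := e_bip; move/setP/(_ x): UWT; move/setP/(_ x): UW0.
by rewrite !inE; case: (x \in U); case: (x \in W).
Qed.

Lemma edge_parts x y : e x y -> (y \in U) = (x \notin U).
Proof.
have [_ _ e_UW] := e_bip; move=> /e_UW; rewrite !in_partW.
by case: (x \in U); case: (y \in U).
Qed.

(** The weights [s] and [t] give both weighted indicators the squared norm [|X| |Y|]. Adding the
    bounds for [f] and [g] gives [2 s t e(X, Y) <= 2 a |X| |Y|]. *)
Lemma max_density_le_rayleigh a : 0 <= a ->
    (forall f, \sum_x \sum_y f x * f y * (e x y)%:R <= a * \sum_x f x ^+ 2) ->
  max_density R e <= a.
Proof.
move=> a0 a_bd; apply/bigmax_leP; split=> // -[X Y] /= /andP[X0 Y0].
have cX : 0 < #|X|%:R :> R by rewrite ltr0n card_gt0.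
have cY : 0 < #|Y|%:R :> R by rewrite ltr0n card_gt0.
pose s : R := Num.sqrt #|Y|%:R; pose t : R := Num.sqrt #|X|%:R.
have s0 : 0 < s by rewrite sqrtr_gt0.
have t0 : 0 < t by rewrite sqrtr_gt0.
have s2 : s ^+ 2 = #|Y|%:R by rewrite sqr_sqrtr // ltW.
have t2 : t ^+ 2 = #|X|%:R by rewrite sqr_sqrtr // ltW.
pose iX z : R := s * (z \in X)%:R; pose iY z : R := t * (z \in Y)%:R.
(* Crossing the parts keeps [X] and [Y] apart even when they intersect. *)
pose f z := if z \in U then iX z else iY z.
pose g z := if z \in U then iY z else iX z.
have := lerD (a_bd f) (a_bd g).
(* The ends of an edge lie in different parts, so [f] produces one of the two mixed products of [iX]
   and [iY], and [g] the other. *)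
have -> : \sum_x \sum_y f x * f y * (e x y)%:R
      + \sum_x \sum_y g x * g y * (e x y)%:R
    = \sum_x \sum_y iX x * iY y * (e x y)%:R
      + \sum_x \sum_y iY x * iX y * (e x y)%:R.
  rewrite -!big_split /=; apply: eq_bigr => x _; rewrite -!big_split /=.
  apply: eq_bigr => y _; rewrite /f /g; case exy : (e x y); last by rewrite !mulr0.
  by rewrite (edge_parts exy); case: (x \in U) => //=; rewrite addrC.
have -> : \sum_x \sum_y iY x * iX y * (e x y)%:R
    = \sum_x \sum_y iX x * iY y * (e x y)%:R.
  rewrite exchange_big; apply: eq_bigr => x _; apply: eq_bigr => y _.
  by rewrite e_sym (mulrC (iX _)).
have -> : \sum_x \sum_y iX x * iY y * (e x y)%:R = s * t * (edges_between e X Y)%:R.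
  rewrite edges_betweenE mulr_sumr [RHS]big_mkcond; apply: eq_bigr => x _ /=.
  rewrite /iX; case: (x \in X); last first.
    by rewrite big1 // => y _; rewrite mulr0 !mul0r.
  rewrite degree_inE mulr_sumr [RHS]big_mkcond; apply: eq_bigr => y _ /=.
  by rewrite /iY; case: (y \in Y); rewrite ?mulr1 // !mulr0 mul0r.
have sumE (Z : {set V}) (c : R) : \sum_z (c * (z \in Z)%:R) ^+ 2 = c ^+ 2 * #|Z|%:R.
  rewrite -sum1_card natr_sum mulr_sumr [RHS]big_mkcond; apply: eq_bigr => z _.
  by case: (z \in Z); rewrite ?mulr1 // mulr0 expr0n.
rewrite -[leRHS]mulrDr -[X in _ <= a * X]big_split /=.
have -> : \sum_z (f z ^+ 2 + g z ^+ 2) = \sum_z iX z ^+ 2 + \sum_z iY z ^+ 2.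
  rewrite -big_split; apply: eq_bigr => z _.
  by rewrite /f /g; case: (z \in U) => //; rewrite addrC.
rewrite !sumE -s2 -t2 => le_st.
have -> : Num.sqrt (t ^+ 2 * s ^+ 2) = t * s.
  by rewrite -exprMn sqrtr_sqr ger0_norm // ltW ?mulr_gt0.
rewrite ler_pdivrMr ?mulr_gt0 // -(ler_pM2l (mulr_gt0 s0 t0)).
have -> : s * t * (a * (t * s)) = a * (s ^+ 2 * t ^+ 2) by ring.
lra.
Qed.

(** * The upper bound for every eigenvalue *)

Hypothesis W_neq0 : W != finset.set0.

Lemma sum_sqr_neighbours_le (D : R) (p : V -> R) :
    (forall u, 0 <= p u) ->
    (forall Y, Y \subset W ->
       \sum_(u in U) (degree_in e Y u)%:R ^+ 2 <= D * #|Y|%:R) ->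
  \sum_(w in W) (\sum_(u in U) p u * (e u w)%:R) ^+ 2
    <= D * (\sum_(u in U) p u ^+ 2) * (1 + ln #|W|%:R).
Proof.
move=> p0 D_bd; pose g w := \sum_(u in U) p u * (e u w)%:R.
have g0 w : 0 <= g w by apply: sumr_ge0 => u _; rewrite mulr_ge0.
have sum_g Y : Y \subset W ->
    (\sum_(w in Y) g w) ^+ 2 <= D * (\sum_(u in U) p u ^+ 2) * #|Y|%:R.
  (* Exchanging sums pairs [p] with the degrees into [Y], so Cauchy-Schwarz brings in [D_bd]. *)
  move=> YW; have -> : \sum_(w in Y) g w = \sum_(u in U) p u * (degree_in e Y u)%:R.
    by rewrite exchange_big; apply: eq_bigr => u _; rewrite degree_inE mulr_sumr.
  apply: le_trans (cauchy_schwarz_sum _ _ _) _; rewrite mulrAC mulrC.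
  by rewrite ler_wpM2r ?D_bd // sumr_ge0 // => u _; exact: sqr_ge0.
set d := [seq g w | w <- enum W].
have szd : size d = #|W| by rewrite size_map cardE.
have d0 : all (>= 0) d by apply/allP => _ /mapP[w _ ->]; exact: g0.
have -> : \sum_(w in W) (g w) ^+ 2 = \sum_(i < #|W|) (sort >=%R d)`_i ^+ 2.
  rewrite -(sum_take (fun x => x ^+ 2)) ?size_sort ?szd //.
  rewrite take_oversize ?size_sort ?szd // (perm_big d) /= ?big_map ?big_enum //.
  by rewrite perm_sort.
apply: sum_sqr_le_harmonic; first by rewrite card_gt0.
- by move=> i j; rewrite -szd; exact: sort_ge_nth.
- by move=> i _; exact: sort_ge0_nth.
- exact: sort_partial_sums.
Qed.

Hypothesis U_neq0 : U != finset.set0.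

Lemma rho_degree_le Y : Y != finset.set0 -> Y \subset W ->
  1 <= rho [seq (degree_in e Y u)%:R : R | u <- enum U] <= max_rho R e U W.
Proof.
move=> Y0 YW; rewrite rho_ge1 /=; last by apply/allP => _ /mapP[u _ ->].
by apply: le_bigmax_cond; rewrite Y0.
Qed.

(** This is [sum_sqr_le_rho] with [C = M^2 |Y|], followed by monotonicity of [ln]. *)
Lemma sum_sqr_degree_le Y : Y \subset W ->
  \sum_(u in U) (degree_in e Y u)%:R ^+ 2
    <= 2 * max_density R e ^+ 2 * (1 + ln (max_rho R e U W)) * #|Y|%:R.
Proof.
move=> YW; have [->|Y0] := eqVneq Y finset.set0.
  by rewrite cards0 mulr0 big1 // => u _; rewrite degree_inE big_set0 expr0n.
have /andP[rho1 rhoK] := rho_degree_le Y0 YW.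
set d := [seq _ | u <- enum U] in rho1 rhoK.
have -> : \sum_(u in U) (degree_in e Y u)%:R ^+ 2 = \sum_(x <- d) x ^+ 2.
  by rewrite big_map big_enum.
have C0 : 0 <= max_density R e ^+ 2 * #|Y|%:R by rewrite mulr_ge0 ?sqr_ge0.
have /le_trans -> // : \sum_(x <- d) x ^+ 2
    <= 2 * (max_density R e ^+ 2 * #|Y|%:R) * (1 + ln (rho d)).
  apply: sum_sqr_le_rho.
  - by rewrite -size_eq0 size_map -cardE cards_eq0.
  - by apply/allP => _ /mapP[u _ ->].
  - rewrite size_map -cardE; apply: sort_partial_sums => X _.
    exact: sqr_sum_degree_le.
rewrite [leRHS]mulrAC -(mulrA 2 _ #|Y|%:R) ler_wpM2l //; first by rewrite mulr_ge0.
by rewrite lerD2l ler_ln // posrE; lra.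
Qed.

Lemma eigenvalue_adjacency_le a : eigenvalue (adjacency R e) a ->
  a <= Num.sqrt (2 * (ln (max_rho R e U W) + 1) * (ln (#|W|%:R : R) + 4))
        * max_density R e.
Proof.
set K := max_rho _ _ _ _; set M := max_density _ _.
have K1 : 1 <= K.
  by have /andP[] := rho_degree_le W_neq0 (subxx W); exact: le_trans.
have lnK := ln_ge0 K1.
have lnW : 0 <= ln (#|W|%:R : R) by rewrite ln_ge0 // ler1n card_gt0.
have M0 : 0 <= M := max_density_ge0.
have bd0 : 0 <= 2 * (ln K + 1) * (ln (#|W|%:R : R) + 4).
  by rewrite !mulr_ge0 ?addr_ge0.
have [a_le0 _|a_gt0] := leP a 0.
  by rewrite (le_trans a_le0) // mulr_ge0 // sqrtr_ge0.
move=> /eigenvalueP[v v_eig v_neq0]; pose x z := v 0 (enum_rank z).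
have x_eig w : \sum_z x z * (e z w)%:R = a * x w.
  by rewrite -adjacency_mulE v_eig mxE.
have x_eigU u : u \in U -> \sum_(z in W) x z * (e z u)%:R = a * x u.
  move=> uU; rewrite -x_eig [RHS](bigID (mem W)) /= [X in _ = _ + X]big1 ?addr0 //.
  move=> z zW; case ezu : (e z u); rewrite ?mulr0 //.
  by move: (edge_parts ezu); rewrite uU -in_partW (negPf zW).
have x_eigW w : w \in W -> \sum_(z in U) x z * (e z w)%:R = a * x w.
  move=> wW; rewrite -x_eig [RHS](bigID (mem U)) /= [X in _ = _ + X]big1 ?addr0 //.
  move=> z zU; case ezw : (e z w); rewrite ?mulr0 //.
  by move: (edge_parts ezw) wW; rewrite in_partW zU => ->.
(* Multiplied by [a], both sides equal the bilinear form of the biadjacency matrix at the two halves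
   of [x]. *)
have eqUW : \sum_(u in U) x u ^+ 2 = \sum_(w in W) x w ^+ 2.
  apply: (mulfI (lt0r_neq0 a_gt0)); rewrite !mulr_sumr.
  under eq_bigr => u uU do rewrite expr2 mulrA -x_eigU // mulr_suml.
  under [RHS]eq_bigr => w wW do rewrite expr2 mulrA -x_eigW // mulr_suml.
  rewrite exchange_big; apply: eq_bigr => u _; apply: eq_bigr => w _.
  by rewrite e_sym; ring.
have N_gt0 : 0 < \sum_(u in U) x u ^+ 2.
  rewrite lt_def sumr_ge0 ?andbT => [|u _]; last exact: sqr_ge0.
  apply: contraNneq v_neq0 => xU0; have xW0 := etrans (esym eqUW) xU0.
  have x0 z : x z = 0.
    apply/eqP; rewrite -sqrf_eq0; case: (boolP (z \in U)) => zU.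
      by rewrite (psumr_eq0P _ xU0) // => i _; exact: sqr_ge0.
    by rewrite (psumr_eq0P _ xW0) ?in_partW // => i _; exact: sqr_ge0.
  by apply/eqP/rowP => j; rewrite mxE -[j]enum_valK; exact: x0.
(* Absolute values supply the non-negative weights; by the triangle inequality they only enlarge the
   neighbour sums. *)
have := sum_sqr_neighbours_le (fun u => normr_ge0 (x u)) sum_sqr_degree_le.
under [X in _ * X * _]eq_bigr do rewrite real_normK ?num_real //.
have : a ^+ 2 * \sum_(w in W) x w ^+ 2
    <= \sum_(w in W) (\sum_(u in U) `|x u| * (e u w)%:R) ^+ 2.
  rewrite mulr_sumr ler_sum // => w wW; rewrite -exprMn -x_eigW //.
  rewrite -[leLHS]real_normK ?num_real // ler_sqr ?nnegrE //; last first.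
    by apply: sumr_ge0 => u _; rewrite mulr_ge0.
  apply: le_trans (ler_norm_sum _ _ _) _; apply: ler_sum => u _.
  by rewrite normrM (normr_nat _ (e u w)).
move=> /le_trans /[apply]; rewrite -eqUW -/K -/M.
rewrite [leRHS]mulrAC ler_pM2r // => a2.
rewrite -ler_sqr ?nnegrE ?mulr_ge0 ?sqrtr_ge0 ?(ltW a_gt0) //.
rewrite exprMn sqr_sqrtr //; apply: le_trans a2 _.
rewrite [leRHS]mulrC [2 * _]mulrC (addrC 1 (ln K)) -!mulrA ler_wpM2l ?sqr_ge0 //.
(* What remains is [1 + ln |W| <= ln |W| + 4]. *)
by rewrite !mulrA ler_wpM2l ?mulr_ge0 ?addr_ge0 //; lra.
Qed.

End Graph.

(** * Comparison of the largest eigenvalue with the maximal density *)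

Theorem theorem3 (R : realType) (V : finType) (e : rel V) (U W : {set V})
    (G_simple : simple_graph e) (G_bip : bipartite_sets e U W)
    (U_neq0 : U != finset.set0) (W_neq0 : W != finset.set0) :
  max_density R e <= lambda_max R e /\
  lambda_max R e <=
    Num.sqrt (2 * (ln (max_rho R e U W) + 1) * (ln (#|W|%:R : R) + 4))
      * max_density R e.
Proof.
have [e_sym _] := G_simple.
have /card_gt0P [u0 _] : (0 < #|U|)%N by rewrite card_gt0.
have V_gt0 : (0 < #|V|)%N by apply/card_gt0P; exists u0.
have [a a_eig a_bd] := exists_rayleigh_bound R e_sym V_gt0.
have bd := eigenvalue_adjacency_le e_sym G_bip W_neq0 U_neq0.
(* The eigenvalue [a] shows that the set under the supremum is non-empty, and [bd] that it is
   bounded above. *)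
split; last by apply: ge_sup => [|b]; [exists a | exact: bd].
apply: (@le_trans _ _ a); last by apply: ub_le_sup => //; eexists => b; exact: bd.
apply: (max_density_le_rayleigh e_sym G_bip _ a_bd).
(* Testing on the indicator of one vertex shows [0 <= a]: the form is non-negative there and the
   squared norm is 1. *)
have := a_bd (fun z => (z == u0)%:R).
rewrite (bigD1 u0) //= [X in _ * X](bigD1 u0) //= eqxx expr1n.
rewrite [X in _ <= _ * (_ + X)]big1 ?addr0 ?mulr1 => [|z /negPf->];
  last by rewrite expr0n.
apply: le_trans; rewrite addr_ge0 ?sumr_ge0 // => *.
  by rewrite !mulr_ge0.
by rewrite sumr_ge0 // => *; rewrite !mulr_ge0.
Qed.
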